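(* Let $\{\boldsymbol Z_n\}_{n\ge0}$ be a block lower Hessenberg branching process with type set $\mathcal{X}_d$, and let $A,B\subseteq\mathcal{X}_d$. If $\sup_{i\in B}q_{0,i}(A)<1$, then $\boldsymbol q(A)\le\boldsymbol q(B)$ (entrywise).
   Context: Fix an integer $1\le d<\infty$ and let $\mathcal{X}_d=\{\langle k,i\rangle: k\ge 0,\ 1\le i\le d\}$ (type $\langle k,i\rangle$ is in level $k$). A block lower Hessenberg branching process is a multitype Galton–Watson process $\{\boldsymbol Z_n\}_{n\ge0}$, $\boldsymbol Z_n=(Z_{n,j})_{j\in\mathcal{X}_d}$ (number of type-$j$ individuals in generation $n$), started from one individual of type $\varphi_0$, in which each individual lives one generation and, independently of all others, an individual of type $j$ produces offspring vector $\boldsymbol r=(r_l)_{l\in\mathcal{X}_d}$ ($r_l\in\{0,1,2,\dots\}$) with probability $p_j(\boldsymbol r)$, where for $j$ in level $k$ the distribution $p_j$ is concentrated on vectors with $r_l=0$ for all $l$ in levels larger than $k+1$. $\mathbb P_i=\mathbb P(\cdot\mid\varphi_0=i)$. For $A\subseteq\mathcal{X}_d$ and $n\ge0$ let $\mathcal{E}_n(A)=\{\sum_{m=n}^\infty\sum_{i\in A}Z_{m,i}=0\}$ and $\mathcal{E}(A)=\lim_{n\to\infty}\mathcal{E}_n(A)=\bigcup_n\mathcal{E}_n(A)$. Set $q_{n,i}(A)=\mathbb P_i(\mathcal{E}_n(A))$ and $q_i(A)=\mathbb P_i(\mathcal{E}(A))$, $\boldsymbol q(A)=(q_i(A))_{i\in\mathcal{X}_d}$.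 In particular $q_{0,i}(A)$ is the probability that no individual with type in $A$ ever appears (generation $0$ included), starting from type $i$. *)

(* Defs.v *)
From mathcomp Require Import all_boot all_order all_algebra finmap.
From mathcomp Require Import all_classical all_reals all_analysis.

Set Implicit Arguments.
Unset Strict Implicit.
Unset Printing Implicit Defensive.
Import Order.TTheory GRing.Theory Num.Theory.
Local Open Scope classical_set_scope.
Local Open Scope ring_scope.
Local Open Scope ereal_scope.

(* (k, i) is the type <k, i+1>: level k, position i (0-based) in that level. *)
Notation itype d := (nat * 'I_d)%type.

Definition level (d : nat) (j : itype d) : nat := j.1.

Definition population (d : nat) : Type := itype d -> nat.

Definition single (d : nat) (i : itype d) : population d :=
  fun j => (j == i) : nat.

(* [p j r] is the probability that a type-j individual has offspring vector r;
   the mass of p j is one, so p j has countable support. *)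
Record block_lower_hessenberg (R : realType) (d : nat)
    (p : itype d -> population d -> R) : Prop := BlockLowerHessenberg {
  offspring_ge0 : forall j r, (0 <= p j r)%R ;
  offspring_mass1 : forall j, \esum_(r in [set: population d]) (p j r)%:E = 1 ;
  offspring_hessenberg : forall (j : itype d) (r : population d) (l : itype d),
    p j r != 0%R -> ((level j).+1 < level l)%N -> r l = 0%N }.

(* Label of a potential individual: (n, j, k) is the k-th individual (counted
   from 0) of type j in generation n. *)
Notation individual d := (nat * itype d * nat)%type.

Definition type_of (d : nat) (a : individual d) : itype d := a.1.2.

(* Under P, [xi a] is the offspring vector of individual a. The recursion is written in
   \bar R because its right-hand side sums over all types; requiring it
   almost surely is enough since only the law of Z matters. *)
Record branching_representation (R : realType) (d : nat)
    (p : itype d -> population d -> R)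
    (disp : measure_display) (T : measurableType disp) (P : probability T R)
    (i : itype d) (xi : individual d -> T -> population d)
    (Z : nat -> T -> population d) : Prop := BranchingRepresentation {
  xi_measurable : forall a l, measurable_fun setT (fun w => xi a w l) ;
  xi_law : forall a r, P [set w | xi a w = r] = (p (type_of a) r)%:E ;
  (* Product rule on points: it is mutual independence because each xi a has a
     discrete law. *)
  xi_independent : forall (s : {fset individual d})
      (r : individual d -> population d),
    P (\bigcap_(a in [set` s]) [set w | xi a w = r a]) =
    \prod_(a <- s) P [set w | xi a w = r a] ;
  Z_measurable : forall n l, measurable_fun setT (fun w => Z n w l) ;
  Z_init : {ae P, forall w, Z 0%N w = single i} ;
  Z_step : {ae P, forall w, forall n l,
    (Z n.+1 w l)%:R%:E =
    \esum_(j in [set: itype d])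
      (\sum_(k < Z n w j) xi (n, j, val k) w l)%N%:R%:E :> \bar R} }.

(* Under P, Z is the multitype Galton-Watson process with offspring law p
   started from one individual of type i. *)
Definition branching_process (R : realType) (d : nat)
    (p : itype d -> population d -> R)
    (disp : measure_display) (T : measurableType disp) (P : probability T R)
    (i : itype d) (Z : nat -> T -> population d) : Prop :=
  exists xi, branching_representation p P i xi Z.

Definition extinct_from (R : realType) (d : nat)
    (disp : measure_display) (T : measurableType disp)
    (Z : nat -> T -> population d) (n : nat) (A : set (itype d)) : set T :=
  [set w | \sum_(n <= m <oo) \esum_(i in A) (Z m w i)%:R%:E = 0 :> \bar R].

Definition extinct (R : realType) (d : nat)
    (disp : measure_display) (T : measurableType disp)
    (Z : nat -> T -> population d) (A : set (itype d)) : set T :=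
  \bigcup_n extinct_from R Z n A.

(* [P i] is the law P(. | phi_0 = i). *)
Definition q_from (R : realType) (d : nat)
    (disp : measure_display) (T : measurableType disp)
    (P : itype d -> probability T R) (Z : nat -> T -> population d)
    (n : nat) (A : set (itype d)) (i : itype d) : \bar R :=
  P i (extinct_from R Z n A).

Definition q (R : realType) (d : nat)
    (disp : measure_display) (T : measurableType disp)
    (P : itype d -> probability T R) (Z : nat -> T -> population d)
    (A : set (itype d)) (i : itype d) : \bar R :=
  P i (extinct R Z A).

(* Main.v *)
(** Let [sup_B q_0(A) < c < 1]. Fix [m] and let [D] be the event that [A] is
    avoided from generation [m] on while [B] is visited infinitely often. For
    [N >= m] split [D] according to the first generation [n >= N] in which [B]
    is visited. By the Markov property, and because extra individuals only make
    it harder to avoid [A], given the past up to this generation the probability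
    that [A] is avoided from then on is at most [c]. Summing over [n],
    [P D <= c * P (A avoided during [m, N), B visited after N)], and letting [N]
    tend to infinity gives [P D <= c * P D], hence [P D = 0].

    The Markov property is used only through a formula for the probability that
    the path [Z_0, Z_1, ...] meets prescribed constraints, proved by revealing
    the offspring of one individual at a time. *)
Require Import Defs.
From mathcomp Require Import all_boot all_order all_algebra finmap zify lra.
From mathcomp Require Import all_classical all_reals all_analysis.

Import Order.TTheory GRing.Theory Num.Theory.
Set Implicit Arguments.
Unset Strict Implicit.
Unset Printing Implicit Defensive.
Local Open Scope classical_set_scope.
Local Open Scope ring_scope.
Local Open Scope ereal_scope.

Lemma esumZl (R : realType) (I : choiceType) (D : set I) (c : R)
    (a : I -> \bar R) : (0 <= c)%R -> (forall i, 0 <= a i) ->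
  \esum_(i in D) (c%:E * a i) = c%:E * \esum_(i in D) a i.
Proof.
move=> c0 a0; rewrite /esum -ereal_supZl//; last first.
  by apply/set0P; exists (\sum_(x \in set0) a x), set0 => //; exact: fsets_set0.
congr ereal_sup; rewrite image_comp; apply: eq_imagel => A _ /=.
by rewrite ge0_mule_fsumr.
Qed.

(** * Averages over the total offspring of finitely many parents, and path probabilities *)

Section progeny.
Context (R : realType) (d : nat) (p : itype d -> population d -> R).
Context (hp : block_lower_hessenberg p).
Implicit Types (x y z r : population d) (L : seq (itype d)).

Definition popD x y : population d := fun l => (x l + y l)%N.

Lemma popDC : commutative popD.
Proof. by move=> x y; apply/funext => l; rewrite /popD addnC. Qed.

Lemma popDA : associative popD.
Proof. by move=> x y z; apply/funext => l; rewrite /popD addnA. Qed.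

(** For nonnegative [g] this is the expectation of [g] at the sum of independent offspring vectors,
    one per type in [L], as an iterated sum. *)
Fixpoint progeny L (g : population d -> \bar R) : \bar R :=
  if L is j :: L' then
    \esum_(r in [set: population d]) ((p j r)%:E * progeny L' (g \o popD r))
  else g (fun=> 0%N).

Let p0 j r : 0 <= (p j r)%:E.
Proof. by rewrite lee_fin; exact: offspring_ge0. Qed.

Lemma progeny_ge0 L g : (forall x, 0 <= g x) -> 0 <= progeny L g.
Proof.
elim: L g => [|j L IH] g g0 //=; apply: esum_ge0 => r _.
by rewrite mule_ge0// IH// => x; exact: g0.
Qed.

Lemma le_progeny L g h : (forall x, g x <= h x) -> progeny L g <= progeny L h.
Proof.
elim: L g h => [|j L IH] g h gh //=; apply: le_esum => r _.
by rewrite lee_wpmul2l// IH// => x; exact: gh.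
Qed.

Lemma progenyZ L (c : R) g : (0 <= c)%R -> (forall x, 0 <= g x) ->
  progeny L (fun x => c%:E * g x) = c%:E * progeny L g.
Proof.
move=> c0; elim: L g => [|j L IH] g g0 //=.
rewrite -esumZl//; last first.
  by move=> r; rewrite mule_ge0// progeny_ge0// => x; exact: g0.
by apply: eq_esum => r _; rewrite muleCA -IH// => x; exact: g0.
Qed.

Lemma progeny1 L : progeny L (fun=> 1) = 1.
Proof.
elim: L => [|j L IH] //=; rewrite -[RHS](offspring_mass1 hp j).
by apply: eq_esum => r _; rewrite [progeny _ _]IH mule1.
Qed.

(** Nonincreasing in the coordinatewise order, phrased with [popD] because [progeny] recurses
    through [g \o popD r]. *)
Definition antitone (g : population d -> \bar R) :=
  forall x y, g (popD x y) <= g y.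

(** As [p j] has mass one, the right-hand side is its own average over [r], and adding [r] to the
    argument of [g] only lowers each term. *)
Lemma progeny_drop j L g : (forall x, 0 <= g x) -> antitone g ->
  progeny (j :: L) g <= progeny L g.
Proof.
move=> g0 ag; have := progeny_ge0 L g0; rewrite /=.
case E : (progeny L g) => [t| |//]; last by rewrite !leey.
rewrite lee_fin => t0.
have -> : t%:E = \esum_(r in [set: population d]) (t%:E * (p j r)%:E).
  by rewrite esumZl// (offspring_mass1 hp) mule1.
apply: le_esum => r _; rewrite muleC lee_wpmul2r// -E.
by apply: le_progeny => x; exact: ag.
Qed.

(** Match or drop the head of [L']. After a match, [g \o popD r] is again antitone because [popD] is
    commutative and associative. *)
Lemma progeny_subseq L L' g : (forall x, 0 <= g x) -> antitone g ->
  subseq L L' -> progeny L' g <= progeny L g.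
Proof.
elim: L' L g => [|j L' IH] L g g0 ag; first by rewrite subseq0 => /eqP ->.
have drop L0 : subseq L0 L' -> progeny (j :: L') g <= progeny L0 g.
  by move=> sL; apply: le_trans (IH _ _ g0 ag sL); exact: progeny_drop.
case: L => [_|i L /=]; first by apply: drop; exact: sub0seq.
case: eqP => [->|_] sL; last exact: (drop (i :: L)).
apply: le_esum => r _; rewrite lee_wpmul2l// IH// => [x|x y /=].
  exact: g0.
by rewrite popDA (popDC r) -popDA; exact: ag.
Qed.

(* Only levels up to [M] are listed. From type [i], generation [n] lives in
   levels at most [level i + n], so over a bounded time horizon a large [M]
   loses nothing and all the sums over types are finite. *)
Definition types M : seq (itype d) :=
  [seq (k, i) | k <- iota 0 M.+1, i <- enum 'I_d].

Lemma mem_types M j : (j \in types M) = (level j <= M)%N.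
Proof.
case: j => k i; apply/allpairsP/idP => [[[k' i'] [+ _ [-> _]]]|kM].
  by rewrite mem_iota add0n ltnS.
by exists (k, i); split; rewrite ?mem_iota ?mem_enum// add0n ltnS.
Qed.

Definition individuals M z : seq (itype d) :=
  [seq j | j <- types M, _ <- iota 0 (z j)].

Lemma individuals_subseq M x z : (forall j, x j <= z j)%N ->
  subseq (individuals M x) (individuals M z).
Proof.
rewrite /individuals => xz; elim: (types M) => [|j s IH]; rewrite ?sub0seq//.
rewrite /=; apply: cat_subseq => //; rewrite -(subnKC (xz j)) iotaD.
by rewrite map_cat prefix_subseq.
Qed.

(** Probability that a process started from [z], in which only levels up to [M] reproduce, meets the
    constraints [Cs] in successive generations. It depends on [p] alone; [prob_path] links it to
    [Z]. *)
Fixpoint path_prob M (Cs : seq (set (population d))) z : \bar R :=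
  if Cs is C :: Cs' then
    if `[< C z >] then progeny (individuals M z) (path_prob M Cs') else 0
  else 1.

Lemma path_prob_ge0 M Cs z : 0 <= path_prob M Cs z.
Proof.
elim: Cs z => [|C Cs IH] z //=.
by case: ifP => // _; exact: progeny_ge0.
Qed.

(** Fewer individuals means a sublist of parents, and by induction the integrand is antitone, so
    [progeny_subseq] applies. The case of interest is [C] saying that [A] is avoided. *)
Lemma path_prob_closed M N (C : set (population d)) :
  (forall x y, C (popD x y) -> C y) -> antitone (path_prob M (nseq N C)).
Proof.
move=> Cdown; elim: N => [|N IH] x y //=.
case: asboolP => [/Cdown Cy|_].
  rewrite asboolT//; apply: progeny_subseq => //.
    exact: path_prob_ge0.
  by apply: individuals_subseq => j; exact: leq_addl.
by case: ifP => // _; apply: progeny_ge0; exact: path_prob_ge0.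
Qed.

(** The Markov property in the form needed: a bound on the future that is uniform in the present
    population passes through any past. *)
Lemma path_prob_cat M Cs Ds Es (c : R) z : (0 <= c)%R ->
  (forall x, path_prob M Ds x <= c%:E * path_prob M Es x) ->
  path_prob M (Cs ++ Ds) z <= c%:E * path_prob M (Cs ++ Es) z.
Proof.
move=> c0 DE; elim: Cs z => [|C Cs IH] z //=.
case: ifP => _; last by rewrite mule0.
by rewrite -progenyZ//; [exact: le_progeny|exact: path_prob_ge0].
Qed.

End progeny.

(** * Countable measurability and almost sure comparison of events *)

Lemma measurable_forall (disp : measure_display) (T : measurableType disp)
    (I : countType) (F : I -> set T) :
  (forall i, measurable (F i)) -> measurable [set w | forall i, F i w].
Proof.
move=> mF; rewrite (_ : [set _ | _] = ~` \bigcup_i ~` F i).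
  apply: measurableC; apply: countable_bigcupT_measurable => // i.
  exact: measurableC.
by rewrite setC_bigcup; apply/seteqP; split=> w /= Fw i; [move=> _|];
  have := Fw i; rewrite setCK//; exact.
Qed.

Lemma measurable_imply (disp : measure_display) (T : measurableType disp)
    (Q : Prop) (D : set T) : measurable D -> measurable [set w | Q -> D w].
Proof.
move=> mD; have [q|nq] := pselect Q.
  rewrite (_ : [set _ | _] = D)//.
  by apply/seteqP; split=> w /=; [exact|].
rewrite (_ : [set _ | _] = setT)//.
by apply/seteqP; split=> w //= _ /nq.
Qed.

Lemma ae_forall_countable (disp : measure_display) (T : measurableType disp)
    (R : realType) (mu : {measure set T -> \bar R}) (I : countType)
    (Q : I -> T -> Prop) :
  (forall i, \forall w \ae mu, Q i w) -> \forall w \ae mu, forall i, Q i w.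
Proof.
move=> aeQ.
have : \forall w \ae mu, forall (n : nat) (i : I), choice.unpickle n = Some i -> Q i w.
  apply: ae_foralln => n; case: (@choice.unpickle I n) => [i|]; last exact: aeW.
  by apply: filterS (aeQ i) => w Qw _ [<-].
by apply: filterS => w Qw i; apply: (Qw (choice.pickle i)); exact: choice.pickleK.
Qed.

Lemma le_measure_ae (disp : measure_display) (T : measurableType disp)
    (R : realType) (mu : {measure set T -> \bar R}) (A B : set T) :
  measurable A -> measurable B -> (\forall w \ae mu, A w -> B w) ->
  mu A <= mu B.
Proof.
move=> mA mB [N [mN N0 sN]].
rewrite -(measureU0 mB mN N0); apply: le_measure; rewrite ?inE//.
  exact: measurableU.
move=> w Aw; have [Nw|Nw] := pselect (N w); [by right|left].
by apply: contrapT => Bw; apply: Nw; apply: sN => /= /(_ Aw).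
Qed.

Lemma eq_measure_ae (disp : measure_display) (T : measurableType disp)
    (R : realType) (mu : {measure set T -> \bar R}) (A B : set T) :
  measurable A -> measurable B -> (\forall w \ae mu, A w <-> B w) ->
  mu A = mu B.
Proof.
move=> mA mB AB; apply/eqP; rewrite eq_le.
by apply/andP; split; apply: le_measure_ae => //; apply: filterS AB => w [].
Qed.

(** Split according to the value of [N]. This serves for sums whose number of terms is a random
    population count. *)
Lemma measurable_fun_select (disp : measure_display) (T : measurableType disp)
    (N : T -> nat) (f : nat -> T -> nat) :
  measurable_fun setT N -> (forall n, measurable_fun setT (f n)) ->
  measurable_fun setT (fun w => f (N w) w).
Proof.
move=> mN mf _ Y mY.
rewrite setTI (_ : _ @^-1` _ = \bigcup_n (N @^-1` [set n] `&` f n @^-1` Y)).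
  apply: bigcupT_measurable => n; apply: measurableI.
    by rewrite -[X in measurable X]setTI; exact: mN.
  by rewrite -[X in measurable X]setTI; exact: mf.
by apply/seteqP; split=> w /= => [Yw|[n _ [/= <-]//]]; exists (N w).
Qed.

(** * Measurability of random populations *)

Section population_events.
Context (d : nat) (disp : measure_display) (T : measurableType disp).
Implicit Types (C : set (population d)) (phi : T -> population d).

Definition measurable_pop phi :=
  forall l, measurable_fun [set: T] (fun w => phi w l).

(* [population d] carries no sigma-algebra, so measurability of a condition is
   tested on all coordinatewise measurable random populations. *)
Definition measurable_cond C :=
  forall phi, measurable_pop phi -> measurable [set w | C (phi w)].

Lemma measurable_count phi (Y : set nat) l :
  measurable_pop phi -> measurable [set w | Y (phi w l)].
Proof. by move=> mphi; rewrite -[X in measurable X]setTI; exact: mphi. Qed.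

Lemma measurable_pop_eq phi r :
  measurable_pop phi -> measurable [set w | phi w = r].
Proof.
move=> mphi; rewrite (_ : [set _ | _] = [set w | forall l, phi w l = r l]).
  by apply: measurable_forall => l; apply: (measurable_count [set r l]).
by apply/seteqP; split=> w /= => [->//|]; exact/funext.
Qed.

Lemma measurable_popD phi psi : measurable_pop phi -> measurable_pop psi ->
  measurable_pop (fun w => popD (phi w) (psi w)).
Proof. by move=> mphi mpsi l; exact: measurable_realfun.measurable_fun_addn. Qed.

Lemma measurable_pop_cst r : measurable_pop (fun=> r).
Proof. by move=> l; exact: measurable_cst. Qed.

End population_events.

(** * From the offspring variables [xi] to the law of the path of [Z] *)

Section representation.
Context (R : realType) (d : nat) (p : itype d -> population d -> R).
Context (hp : block_lower_hessenberg p).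
Context (disp : measure_display) (T : measurableType disp).
Context (P : probability T R) (i : itype d).
Context (xi : individual d -> T -> population d) (Z : nat -> T -> population d).
Context (hr : branching_representation p P i xi Z).
Implicit Types (F : set T) (r z : population d) (a : individual d).

Let mxi a : measurable_pop (xi a).
Proof. by move=> l; exact: (xi_measurable hr). Qed.

Let mxi_eq a r : measurable [set w | xi a w = r].
Proof. exact: measurable_pop_eq. Qed.

Let p0 j r : 0 <= (p j r)%:E.
Proof. by rewrite lee_fin; exact: offspring_ge0. Qed.

Lemma xi_fin_partition a F (X : set (population d)) :
  measurable F -> finite_set X ->
  \sum_(r \in X) P (F `&` [set w | xi a w = r]) =
  P (F `&` \bigcup_(r in X) [set w | xi a w = r]).
Proof.
move=> mF finX; rewrite setI_bigcupr measure_fin_bigcup//.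
  by move=> r s _ _ [w [[_ /= <-] [_ /= <-]]].
by move=> r _; exact: measurableI.
Qed.

(* Finitely many offspring vectors carry all but [e] of the mass, so countability
   of the support is never needed. *)
Lemma xi_partition a F : measurable F ->
  P F = \esum_(r in [set: population d]) P (F `&` [set w | xi a w = r]).
Proof.
move=> mF; apply/eqP; rewrite eq_le; apply/andP; split; last first.
  apply: ge_ereal_sup => _ [X [finX _] <-]; rewrite xi_fin_partition//.
  rewrite le_measure ?inE//; apply: measurableI => //.
  by apply: fin_bigcup_measurable.
apply/lee_addgt0Pr => e e0.
have mass := offspring_mass1 hp (type_of a).
have fin : \esum_(r in [set: population d]) (p (type_of a) r)%:E \is a fin_num.
  by rewrite mass.
have [_ [X [finX _] <-]] := ub_ereal_sup_adherent e0 fin; rewrite [X in X - _]mass => Xe.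
pose U := \bigcup_(r in X) [set w | xi a w = r].
have mU : measurable U by apply: fin_bigcup_measurable.
have PU : P (~` U) <= e%:E.
  rewrite probability_setC// leeBlDl ?fin_num_measure// -leeBlDr//.
  apply: le_trans (ltW Xe) _; rewrite -[U]setTI -xi_fin_partition//.
  by apply: lee_fsum => // r _; rewrite setTI (xi_law hr).
have PF : P F <= P (F `&` U) + P (F `&` ~` U).
  rewrite -{1}[F]setIT -(setUv U) setIUr; apply: measureU2.
    exact: measurableI.
  by apply: measurableI => //; exact: measurableC.
apply: le_trans PF _; apply: leeD; last first.
  apply: le_trans PU; apply: le_measure; rewrite ?inE//.
    by apply: measurableI => //; exact: measurableC.
  exact: measurableC.
rewrite /U -xi_fin_partition//.
by apply: ereal_sup_ubound; exists X.
Qed.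

(* [F] is independent of the offspring of the individuals outside [s]. *)
Definition fresh F (s : set (individual d)) :=
  measurable F /\ forall (t : {fset individual d}) (r : individual d -> population d),
    (forall a, a \in t -> ~ s a) ->
    P (F `&` \bigcap_(a in [set` t]) [set w | xi a w = r a]) =
    P F * \prod_(a <- t) (p (type_of a) (r a))%:E.

Lemma fresh_setT s : fresh setT s.
Proof.
split=> // t r _; rewrite setTI (xi_independent hr) probability_setT mul1e.
by apply: eq_bigr => a _; rewrite (xi_law hr).
Qed.

Lemma fresh_sub F s s' : s `<=` s' -> fresh F s -> fresh F s'.
Proof.
move=> ss [mF Fs]; split=> // t r ts; apply: Fs => a /ts sa.
by move=> /ss.
Qed.

Lemma fresh_xi F s a r : fresh F s -> ~ s a ->
  P (F `&` [set w | xi a w = r]) = P F * (p (type_of a) r)%:E.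
Proof.
move=> [mF Fs] sa; have := Fs [fset a]%fset (fun=> r).
rewrite big_seq_fset1 set_fset1 bigcap_set1; apply.
by move=> b; rewrite inE => /eqP ->.
Qed.

(** Revealing the offspring of [a] costs one factor: apply freshness of [F] to [a] together with
    [t]. *)
Lemma fresh_extend F s a r : fresh F s -> ~ s a ->
  fresh (F `&` [set w | xi a w = r]) (a |` s).
Proof.
move=> Fs sa; have [mF FsE] := Fs; split; first exact: measurableI.
move=> t r' ts; rewrite (fresh_xi r Fs sa).
have ta : a \notin t by apply/negP => /ts; apply; left.
(* One function must prescribe all vectors; overriding it at [a] is harmless since [a] is not in
   [t]. *)
have := FsE (a |` t)%fset (fun b => if b == a then r else r' b).
rewrite big_fsetU1//= eqxx muleA => E.
have -> : \prod_(b <- t) (p (type_of b) (r' b))%:E =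
    \prod_(b <- t) (p (type_of b) (if b == a then r else r' b))%:E.
  by apply: eq_big_seq => b bt; case: eqP bt ta => // -> ->.
rewrite -E => [|b]; last first.
  by rewrite !inE => /orP[/eqP ->//|/ts + sb]; apply; right.
rewrite -setIA; congr (P (F `&` _)); apply/seteqP; split=> w /=.
  move=> [xr xt] b /=; rewrite !inE => /orP[/eqP ->|bt]; first by rewrite eqxx.
  by case: eqP bt ta => [-> ->//|_ bt _]; exact: xt.
move=> xt; split; first by have := xt a; rewrite /= !inE eqxx; exact.
move=> b /= bt; have := xt b; rewrite /= !inE bt orbT => /(_ isT).
by case: eqP bt ta => [-> ->|].
Qed.

Definition offspring_sum (L : seq (individual d)) (w : T) : population d :=
  fun l => (\sum_(a <- L) xi a w l)%N.

Lemma measurable_offspring_sum L : measurable_pop (offspring_sum L).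
Proof.
elim: L => [|a L IH] l.
  rewrite (_ : (fun w => _) = cst 0%N) //; apply/funext => w.
  by rewrite /offspring_sum big_nil.
rewrite (_ : (fun w => _) = (fun w => xi a w l + offspring_sum L w l)%N).
  by apply: measurable_realfun.measurable_fun_addn; [exact: mxi|exact: IH].
by apply/funext => w; rewrite /offspring_sum big_cons.
Qed.

Lemma offspring_sum_nil w : offspring_sum [::] w = fun=> 0%N.
Proof. by apply/funext => l; rewrite /offspring_sum big_nil. Qed.

Lemma offspring_sum_cons a L w :
  offspring_sum (a :: L) w = popD (xi a w) (offspring_sum L w).
Proof. by apply/funext => l; rewrite /offspring_sum big_cons. Qed.

(** Partition by the offspring [r] of the head of [L], absorb this event into [F], and recurse with
    [G \o popD r]. Here [G z] is a future event given total offspring [z], with probability [g z];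
    its product rule is assumed for all [F'] fresh for [s'], since [s'] holds everything revealed by
    the end. *)
Lemma fresh_offspring L F (s s' : set (individual d))
    (G : population d -> set T) (g : population d -> \bar R) :
  uniq L -> (forall a, a \in L -> ~ s a) -> s `<=` s' ->
  (forall a, a \in L -> s' a) ->
  (forall phi, measurable_pop phi -> measurable [set w | G (phi w) w]) ->
  (forall z, 0 <= g z) ->
  (forall F' z, fresh F' s' -> P (F' `&` G z) = P F' * g z) ->
  fresh F s ->
  P (F `&` [set w | G (offspring_sum L w) w]) =
  P F * progeny p (map (@type_of d) L) g.
Proof.
elim: L F s G g => [|a L IH] F s G g /=.
  move=> _ _ ss _ mG g0 GE /(fresh_sub ss) Fs; rewrite -GE//.
  by congr (P (F `&` _)); apply/seteqP; split=> w /=; rewrite offspring_sum_nil.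
move=> /andP[aL uL] sL ss Ls' mG g0 GE Fs.
have mF : measurable F by case: Fs.
have mGL : measurable [set w | G (offspring_sum (a :: L) w) w].
  by apply: mG; exact: measurable_offspring_sum.
have sa : ~ s a by apply: sL; rewrite mem_head.
rewrite (xi_partition a (measurableI _ _ mF mGL)).
have -> : P F = (fine (P F))%:E by rewrite fineK// fin_num_measure.
rewrite -esumZl; last 2 first.
- by rewrite fine_ge0.
- by move=> r; rewrite mule_ge0// progeny_ge0// => x; exact: g0.
apply: eq_esum => r _; rewrite fineK ?fin_num_measure//.
rewrite muleA -(fresh_xi r Fs sa).
have <- := IH _ (a |` s) (G \o popD r) (g \o popD r) uL _ _ _ _ _ _
  (fresh_extend r Fs sa).
- congr (P _); apply/seteqP; split=> w /= [[Fw]].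
    by rewrite offspring_sum_cons => + xr; rewrite xr.
  by move=> xr Gw; rewrite offspring_sum_cons xr.
- move=> b bL [/= ba|]; first by move: aL; rewrite -ba bL.
  by apply: sL; rewrite in_cons bL orbT.
- by move=> b [->|/ss//]; apply: Ls'; rewrite mem_head.
- by move=> b bL; apply: Ls'; rewrite in_cons bL orbT.
- move=> phi mphi; apply: (mG (fun w => popD r (phi w))).
  by apply: measurable_popD => //; exact: measurable_pop_cst.
- by move=> z; exact: g0.
- by move=> F' z; exact: GE.
Qed.

Definition labels M n z : seq (individual d) :=
  [seq (n, j, k) | j <- types d M, k <- iota 0 (z j)].

Lemma offspring_sum_labels M n z w l :
  offspring_sum (labels M n z) w l =
  (\sum_(j <- types d M) \sum_(k < z j) xi (n, j, val k) w l)%N.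
Proof.
rewrite /offspring_sum big_allpairs_dep; apply: eq_bigr => j _.
by rewrite -(big_mkord xpredT (fun k => xi (n, j, k) w l)) /index_iota subn0.
Qed.

Lemma labels_uniq M n z : uniq (labels M n z).
Proof.
apply: allpairs_uniq_dep => [|j _|]; rewrite ?iota_uniq//.
  by apply: allpairs_uniq; rewrite ?iota_uniq ?enum_uniq// => -[? ?] [].
by move=> [j k] [j' k'] _ _ /= [-> ->].
Qed.

Lemma labels_generation M n z a : a \in labels M n z -> a.1.1 = n.
Proof. by move=> /allpairsPdep[j [k [_ _ ->]]]. Qed.

Lemma types_of_labels M n z :
  map (@type_of d) (labels M n z) = individuals M z.
Proof. exact: map_allpairs. Qed.

(** The path is rebuilt from [xi] with a fixed population [z] in generation [n], so that freshness
    applies directly; [Z] itself does not occur. *)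
Fixpoint path_event M n (Cs : seq (set (population d))) z : set T :=
  if Cs is C :: Cs' then
    [set w | C z /\ path_event M n.+1 Cs' (offspring_sum (labels M n z) w) w]
  else setT.

Lemma measurable_path_event M n Cs phi :
  (forall t, measurable_cond T (nth setT Cs t)) -> measurable_pop phi ->
  measurable [set w | path_event M n Cs (phi w) w].
Proof.
elim: Cs n phi => [|C Cs IH] n phi mCs mphi.
  by rewrite (_ : [set _ | _] = setT)//; apply/seteqP.
rewrite (_ : [set _ | _] = [set w | C (phi w)] `&` [set w |
    path_event M n.+1 Cs (offspring_sum (labels M n (phi w)) w) w])//.
apply: measurableI; first exact: (mCs 0%N).
apply: IH => [t|l]; first exact: (mCs t.+1).
under eq_fun do rewrite offspring_sum_labels.
elim: (types d M) => [|j s IHs].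
  by under eq_fun do rewrite big_nil; exact: measurable_cst.
under eq_fun do rewrite big_cons.
apply: measurable_realfun.measurable_fun_addn => //.
(* The number of parents of type [j] is random: prove measurability for each fixed count, then
   select. *)
apply: (measurable_fun_select
  (f := fun k w => (\sum_(k < k) xi (n, j, val k) w l)%N)) => //.
move=> m; elim: m => [|m IHm].
  by under eq_fun do rewrite big_ord0; exact: measurable_cst.
under eq_fun do rewrite big_ord_recr/=.
by apply: measurable_realfun.measurable_fun_addn => //; exact: mxi.
Qed.

(** One use of [fresh_offspring] per generation: the labels of generation [n] are unrevealed when
    only earlier generations have been, and afterwards all generations below [n.+1] count as
    revealed. *)
Lemma fresh_path_event M n Cs F z :
  (forall t, measurable_cond T (nth setT Cs t)) ->
  fresh F [set a | (a.1.1 < n)%N] ->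
  P (F `&` path_event M n Cs z) = P F * path_prob p M Cs z.
Proof.
elim: Cs n F z => [|C Cs IH] n F z mCs Fn /=; first by rewrite setIT mule1.
have mCs' t : measurable_cond T (nth setT Cs t) by exact: (mCs t.+1).
case: asboolP => Cz; last first.
  by rewrite (_ : F `&` _ = set0) ?measure0 ?mule0//; apply/seteqP; split=> w // [_ []].
rewrite -(types_of_labels M n z).
rewrite -(fresh_offspring (s := [set a | (a.1.1 < n)%N])
  (s' := [set a | (a.1.1 < n.+1)%N]) (G := path_event M n.+1 Cs)) //.
- by congr (P (F `&` _)); apply/seteqP; split=> w /= => [[]|].
- exact: labels_uniq.
- by move=> a /labels_generation /= ->; rewrite ltnn.
- by move=> a /= /ltnW.
- by move=> a /labels_generation /= ->; rewrite ltnS.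
- by move=> phi mphi; exact: measurable_path_event.
- by move=> x; exact: path_prob_ge0.
- by move=> F' x; exact: IH.
Qed.

(** Partition the exceptional event by the value [r] of [xi a]: if [r l] is zero the piece is empty,
    otherwise [p] gives [r] mass zero. *)
Lemma ae_xi_hessenberg : \forall w \ae P, forall a l,
  ((level (type_of a)).+1 < level l)%N -> xi a w l = 0%N.
Proof.
apply: ae_forall_countable => a; apply: ae_forall_countable => l.
have mN : measurable [set w | xi a w l <> 0%N].
  exact: (measurable_count (~` [set 0%N]) l (mxi a)).
have [al|al] := boolP ((level (type_of a)).+1 < level l)%N; last exact: aeW.
suff PN : P [set w | xi a w l <> 0%N] = 0.
  by exists [set w | xi a w l <> 0%N]; split=> // w /= Nw xw; apply: Nw.
rewrite (xi_partition a mN); apply: esum1 => r _.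
have [rl|rl] := eqVneq (r l) 0%N.
  rewrite (_ : _ `&` _ = set0) ?measure0//.
  by apply/seteqP; split=> w //= [xl xr]; apply: xl; rewrite xr.
apply/eqP; rewrite eq_le measure_ge0 andbT.
apply: (@le_trans _ _ (P [set w | xi a w = r])).
  by apply: le_measure; rewrite ?inE//; exact: measurableI.
rewrite (xi_law hr); have [->//|pr] := eqVneq (p (type_of a) r) 0%R.
by move: rl; rewrite (offspring_hessenberg hp pr al).
Qed.

(** Lines of descent climb at most one level per generation. Hence the sum over all types in
    [Z_step] is finite and becomes an equality of natural numbers. *)
Lemma ae_population : \forall w \ae P,
  [/\ Z 0 w = single i,
      forall n l, (level i + n < level l)%N -> Z n w l = 0%N &
      forall n M, (level i + n <= M)%N ->
        Z n.+1 w = offspring_sum (labels M n (Z n w)) w].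
Proof.
have Z0 := Z_init hr; have ZS := Z_step hr; have xiH := ae_xi_hessenberg.
near=> w.
have Z0w : Z 0 w = single i by near: w.
have ZSw n l : (Z n.+1 w l)%:R%:E = \esum_(j in [set: itype d])
    (\sum_(k < Z n w j) xi (n, j, val k) w l)%N%:R%:E :> \bar R.
  by move: n l; near: w.
have xiw a l : ((level (type_of a)).+1 < level l)%N -> xi a w l = 0%N.
  by move: a l; near: w.
have supp n l : (level i + n < level l)%N -> Z n w l = 0%N.
  elim: n l => [|n IH] l il.
    rewrite Z0w /single; case: eqP => // li.
    by move: il; rewrite li addn0 ltnn.
  (* Every term vanishes: a type above level [level i + n] has no parents, and the others cannot
     reach the level of [l]. *)
  have := ZSw n l; rewrite esum1 => [[/eqP]|j _].
    by rewrite pnatr_eq0 => /eqP.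
  rewrite big1// => k _; have [ij|ji] := ltnP (level i + n) (level j).
    by case: k => k /=; rewrite IH.
  by rewrite xiw//= ; apply: leq_ltn_trans il; rewrite addnS ltnS.
split=> // n M nM; apply/funext => l; rewrite offspring_sum_labels.
have := ZSw n l.
set f := fun j => _; rewrite (_ : esum _ f = esum (setT `&` [set` types d M]) f).
  rewrite setTI esum_fset//; last exact: finite_seq.
  rewrite -fsbig_seq; last first.
    by apply: allpairs_uniq; rewrite ?iota_uniq ?enum_uniq// => -[? ?] [].
  by rewrite /f sumEFin -natr_sum => -[/eqP]; rewrite eqr_nat => /eqP.
rewrite esum_mkcondr; apply: eq_esum => j _; case: ifPn => //.
rewrite notin_setE /= mem_types => /negP; rewrite -ltnNge => Mj.
by rewrite /f supp ?big_ord0// (leq_ltn_trans nM).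
Unshelve. all: by end_near.
Qed.

(** The bound on [M] covers the parents in all generations below [size Cs], so almost surely
    [path_event] started from [single i] is the path event of [Z]. Its probability is
    [fresh_path_event] with nothing revealed. *)
Lemma prob_path M (Cs : seq (set (population d))) :
  (forall t, measurable_cond T (nth setT Cs t)) ->
  (level i + size Cs <= M.+1)%N ->
  P [set w | forall t, (t < size Cs)%N -> nth setT Cs t (Z t w)] =
  path_prob p M Cs (single i).
Proof.
move=> mCs iM; have mZ t : measurable_pop (Z t) by exact: (Z_measurable hr t).
have mE : measurable
    [set w | forall t, (t < size Cs)%N -> nth setT Cs t (Z t w)].
  apply: measurable_forall => t; apply: measurable_imply; exact: mCs.
rewrite -[RHS]mul1e -(probability_setT P).
rewrite -(@fresh_path_event M 0 Cs setT (single i) mCs (fresh_setT _)) setTI.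
apply: eq_measure_ae => //.
  by apply: (measurable_path_event M 0 mCs); exact: measurable_pop_cst.
apply: filterS ae_population => w [Z0w _ ZSw].
have step n Ds : (level i + n + size Ds <= M.+1)%N ->
    path_event M n Ds (Z n w) w <->
    (forall t, (t < size Ds)%N -> nth setT Ds t (Z (n + t)%N w)).
  elim: Ds n => [|C Ds IH] n /= nM; first by split.
  rewrite -ZSw; last by move: nM; rewrite addnS ltnS; apply: leq_trans; exact: leq_addr.
  have {}IH := IH n.+1; rewrite addnS addSnnS in IH; have {}IH := IH nM.
  split=> [[CZ /IH DZ] [|t] /= tD|CD].
  - by rewrite addn0.
  - by rewrite addnS -addSn; exact: DZ.
  - split; first by have := CD 0%N isT; rewrite addn0.
    by apply/IH => t tD; have := CD t.+1 tD; rewrite addnS -addSn.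
by rewrite -Z0w; apply: iff_sym; apply: step; rewrite addn0.
Qed.

End representation.

(** * Extinction events and the comparison of [A] with [B] *)

Section extinction.
Context (R : realType) (d : nat) (p : itype d -> population d -> R).
Context (hp : block_lower_hessenberg p).
Context (disp : measure_display) (T : measurableType disp).
Context (P : itype d -> probability T R) (Z : nat -> T -> population d).
Context (hZ : forall i, branching_process p (P i) i Z).
Implicit Types (A B : set (itype d)) (Cs : seq (set (population d))).

Definition none A : set (population d) := [set z | forall l, A l -> z l = 0%N].

Lemma measurable_none A : measurable_cond T (none A).
Proof.
move=> phi mphi; apply: measurable_forall => l.
by apply: measurable_imply; exact: (measurable_count [set 0%N] l mphi).
Qed.

Lemma measurable_condC (C : set (population d)) :
  measurable_cond T C -> measurable_cond T (~` C).
Proof. by move=> mC phi /mC; exact: measurableC. Qed.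

Lemma measurable_condI (C D : set (population d)) :
  measurable_cond T C -> measurable_cond T D -> measurable_cond T (C `&` D).
Proof. by move=> mC mD phi mphi; apply: measurableI; [exact: mC|exact: mD]. Qed.

Lemma measurable_condT : measurable_cond T (setT : set (population d)).
Proof. by move=> phi _; exact: measurableT. Qed.

(** Measurability of [Z] is read off a representation, so a starting type must be named; hence the
    argument [i] here and in later measurability lemmas. *)
Let mZ (i : itype d) t : measurable_pop (Z t).
Proof. by have [xi hr] := hZ i; exact: (Z_measurable hr t). Qed.

Lemma extinct_fromE n A :
  extinct_from R Z n A = [set w | forall m, (n <= m)%N -> none A (Z m w)].
Proof.
have Z0 m w l : 0 <= (Z m w l)%:R%:E :> \bar R by rewrite lee_fin.
apply/seteqP; split=> w /=.
  move=> E m nm l Al; have : (Z m w l)%:R%:E <= 0 :> \bar R.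
    rewrite -E; apply: (@le_trans _ _ (\esum_(l in A) (Z m w l)%:R%:E)).
      apply: esum_ge; exists [set l]; last by rewrite fsbig_set1.
      by split=> // _ ->.
    have s0 k : 0 <= \esum_(l in A) (Z k w l)%:R%:E :> \bar R by exact: esum_ge0.
    apply: le_trans (nneseries_lim_ge m.+1 _) => //.
    by rewrite big_nat_recr//= leeDr// sume_ge0.
  by rewrite lee_fin lern0 => /eqP.
move=> E; apply: eseries0 => m nm _; apply: esum1 => l Al.
by rewrite E.
Qed.

Lemma prob_path_process M Cs i :
  (forall t, measurable_cond T (nth setT Cs t)) ->
  (level i + size Cs <= M.+1)%N ->
  P i [set w | forall t, (t < size Cs)%N -> nth setT Cs t (Z t w)] =
  path_prob p M Cs (single i).
Proof. by have [xi hr] := hZ i; exact: (prob_path hp hr). Qed.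

Lemma measurable_path Cs (i : itype d) :
  (forall t, measurable_cond T (nth setT Cs t)) ->
  measurable [set w | forall t, (t < size Cs)%N -> nth setT Cs t (Z t w)].
Proof.
move=> mCs.
apply: measurable_forall => t; apply: measurable_imply.
exact: (mCs _ _ (mZ i t)).
Qed.

Definition avoids A n : set T := [set w | forall t, (t < n)%N -> none A (Z t w)].

Lemma nth_nseq_none A n t : (t < n)%N -> nth setT (nseq n (none A)) t = none A.
Proof. by rewrite nth_nseq => ->. Qed.

Lemma avoidsE A n : avoids A n =
  [set w | forall t, (t < size (nseq n (none A)))%N ->
    nth setT (nseq n (none A)) t (Z t w)].
Proof.
by rewrite size_nseq; apply/seteqP; split=> w /= Aw t tn; have := Aw t tn;
  rewrite nth_nseq_none.
Qed.

Lemma measurable_cond_nseq A n t :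
  measurable_cond T (nth setT (nseq n (none A)) t).
Proof.
by rewrite nth_nseq; case: ifP => _; [exact: measurable_none|exact: measurable_condT].
Qed.

Lemma measurable_avoids (i : itype d) A n : measurable (avoids A n).
Proof.
by rewrite avoidsE; apply: (measurable_path i) => t;
  exact: measurable_cond_nseq.
Qed.

Lemma measurable_extinct_from (i : itype d) n A : measurable (extinct_from R Z n A).
Proof.
rewrite extinct_fromE; apply: measurable_forall => m; apply: measurable_imply.
exact: (@measurable_none A _ (mZ i m)).
Qed.

(** Continuity from above: the events [avoids A n] decrease to avoidance for ever, so the strict
    bound on the limit is reached at a finite horizon, as [path_prob] requires. *)
Lemma prob_avoids_lt A j (c : R) : q_from P Z 0 A j < c%:E ->
  exists n, forall m, (n <= m)%N -> P j (avoids A m) <= c%:E.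
Proof.
move=> qc; suff [n nc] : exists n, P j (avoids A n) <= c%:E.
  exists n => m nm; apply: le_trans nc; apply: le_measure; rewrite ?inE.
  - exact: measurable_avoids.
  - exact: measurable_avoids.
  - by move=> w Aw t tn; apply: Aw; exact: leq_trans nm.
have E : extinct_from R Z 0 A = \bigcap_n avoids A n.
  rewrite extinct_fromE; apply/seteqP; split=> w /= Aw.
    by move=> n _ t _; exact: Aw.
  by move=> m _; exact: (Aw m.+1 I m).
have : P j (avoids A n) @[n --> \oo] --> q_from P Z 0 A j.
  rewrite /q_from E; apply: nonincreasing_cvg_mu.
  - by rewrite -ge0_fin_numE// fin_num_measure//; exact: measurable_avoids.
  - by move=> n; exact: measurable_avoids.
  - by rewrite -E; exact: measurable_extinct_from.
  - move=> m n mn; apply/subsetPset => w Aw t tm.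
    by apply: Aw; exact: leq_trans mn.
move=> qcvg; apply: contrapT => /forallNP nc.
have : c%:E <= q_from P Z 0 A j.
  apply: cvge_ge qcvg; apply: nearW => n.
  by rewrite leNgt; apply/negP => /ltW /nc.
by rewrite leNgt qc.
Qed.

(** The maximum of finitely many horizons serves all of [s]. The form [n.+1] separates the present
    generation from the [n] following ones. *)
Lemma prob_avoids_lt_seq A B (c : R) (s : seq (itype d)) :
  (forall j, B j -> q_from P Z 0 A j < c%:E) ->
  exists n, forall j, j \in s -> B j -> P j (avoids A n.+1) <= c%:E.
Proof.
move=> Bc; suff [n nc] : exists n, forall m j, (n <= m)%N -> j \in s -> B j ->
    P j (avoids A m) <= c%:E.
  by exists n => j js Bj; exact: nc.
elim: s => [|j s [n IH]]; first by exists 0%N.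
have [Bj|Bj] := pselect (B j).
  have [n' n'P] := prob_avoids_lt (Bc j Bj).
  exists (maxn n n') => m k; rewrite geq_max => /andP[nm n'm].
  rewrite in_cons => /orP[/eqP -> _|ks Bk]; first exact: n'P.
  exact: IH.
by exists n => m k nm; rewrite in_cons => /orP[/eqP -> //|ks Bk]; exact: IH.
Qed.

(* Keep one individual with type in [B] of generation [size Cs]: dropping all the
   others can only increase the probability that [A] is avoided. *)
Lemma extinction_after_visit A B (c : R) Cs i (F : set T) : (0 <= c)%R ->
  (forall j, B j -> q_from P Z 0 A j < c%:E) ->
  (forall t, measurable_cond T (nth setT Cs t)) ->
  F = [set w | forall t, (t < size Cs)%N -> nth setT Cs t (Z t w)] `&`
    [set w | ~ none B (Z (size Cs) w)] ->
  P i (F `&` extinct_from R Z (size Cs) A) <= c%:E * P i F.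
Proof.
(* Generation [n] lives in levels up to [K], so only finitely many types of [B] can be visited then
   and one horizon [N] suits them all. *)
move=> c0 Bc mCs FE; set n := size Cs; pose K := (level i + n)%N.
have [N NP] := prob_avoids_lt_seq (types d K) Bc.
pose M := (K + N.+1)%N.
(* A visit to [B] at a level covered by [N]; in generation [n] this is almost surely any visit to
   [B]. *)
pose hits := [set z : population d | exists2 l, B l & (level l <= K)%N /\ z l <> 0%N].
have mhits : measurable_cond T hits.
  rewrite (_ : hits = ~` none [set l | B l /\ (level l <= K)%N]).
    by apply: measurable_condC; exact: measurable_none.
  apply/seteqP; split=> z /=; first by move=> [l Bl [lK zl]] /(_ l (conj Bl lK)).
  move=> zB; apply: contrapT => nz; apply: zB => l [Bl lK].
  by apply: contrapT => zl; apply: nz; exists l.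
pose tl := (hits `&` none A) :: nseq N (none A).
have mF : measurable F.
  rewrite FE.
  apply: measurableI; first exact: (measurable_path i).
  exact: (measurable_condC (@measurable_none B) (mZ i n)).
have mCs1 t : measurable_cond T (nth setT (Cs ++ [:: hits]) t).
  rewrite nth_cat; case: ifP => // _; case: (t - _)%N => [|k] //=.
  by rewrite nth_nil; exact: measurable_condT.
have mCs2 t : measurable_cond T (nth setT (Cs ++ tl) t).
  rewrite nth_cat; case: ifP => // _; case: (t - _)%N => [|k] /=.
    by apply: measurable_condI => //; exact: measurable_none.
  exact: measurable_cond_nseq.
apply: (@le_trans _ _ (path_prob p M (Cs ++ tl) (single i))).
  rewrite -prob_path_process//; last by rewrite size_cat /= size_nseq /M /K; lia.
  apply: le_measure_ae.
  - by apply: measurableI => //; exact: (measurable_extinct_from i).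
  - exact: (measurable_path i).
  have [xi hr] := hZ i; apply: filterS (ae_population hp hr) => w [_ supp _].
  rewrite FE extinct_fromE => -[[Cw Bw] Aw] t; rewrite size_cat /= size_nseq => tn.
  rewrite nth_cat; case: ltnP => [tC|Ct]; first exact: Cw.
  rewrite /tl; case E : (t - size Cs)%N => [|k] /=; last first.
    rewrite nth_nseq; case: ifP => // _; exact: Aw.
  have -> : t = n by rewrite /n; lia.
  split; last exact: Aw.
  apply: contrapT => nz; apply: Bw => l Bl; apply: contrapT => zl; apply: nz.
  exists l => //; split=> //; rewrite leqNgt; apply/negP => Kl.
  by apply: zl; exact: supp.
apply: (@le_trans _ _ (c%:E * path_prob p M (Cs ++ [:: hits]) (single i))).
  (* The last constraint [hits] alone has probability one from any [z] satisfying it, so it remains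
     to bound the avoidance of [A] from such a [z] by [c]. *)
  apply: path_prob_cat => // z /=.
  have [hz|hz] := pselect (hits z); last first.
    by rewrite asboolF ?asboolF ?mule0// => -[].
  rewrite [X in _ * X]ifT; last exact/asboolP.
  rewrite progeny1// mule1.
  have [l Bl [lK zl]] := hz.
  apply: le_trans (NP l _ Bl); last by rewrite mem_types.
  rewrite avoidsE (@prob_path_process M)//; last 2 first.
  - by move=> t; exact: measurable_cond_nseq.
  - by rewrite size_nseq /M; lia.
  apply: (@le_trans _ _ (path_prob p M (nseq N.+1 (none A)) z)).
    rewrite /=; case: asboolP => [[_ Az]|_]; first by rewrite asboolT.
    by have := path_prob_ge0 hp M (nseq N.+1 (none A)) z.
  have -> : z = popD (fun j => z j - single l j)%N (single l).
    apply/funext => j; rewrite /popD subnK// /single; case: eqP => // ->.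
    by rewrite lt0n; exact/eqP.
  apply: path_prob_closed => // x y; rewrite /none /popD /= => xy k Ak.
  by have /eqP := xy k Ak; rewrite addn_eq0 => /andP[_ /eqP].
rewrite lee_wpmul2l// -prob_path_process//; last first.
  by rewrite size_cat /= /M /K; lia.
apply: le_measure; rewrite ?inE//; first exact: (measurable_path i).
rewrite FE => w Cw; split=> [t tn|Bw].
  by have := Cw t; rewrite size_cat /= nth_cat tn; apply; lia.
have := Cw n; rewrite size_cat nth_cat ltnn subnn /= addn1 leqnn => /(_ isT).
by move=> [l Bl [_]]; apply; exact: Bw.
Qed.

Lemma extinct_null A B (c : R) m i : (0 <= c < 1)%R ->
  (forall j, B j -> q_from P Z 0 A j < c%:E) ->
  P i (extinct_from R Z m A `\` extinct R Z B) = 0.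
Proof.
move=> /andP[c0 c1] Bc; set D := _ `\` _.
have mB (t : nat) : measurable [set w | ~ none B (Z t w)].
  exact: (measurable_condC (@measurable_none B) (mZ i t)).
have mD : measurable D.
  apply: measurableD; first exact: (measurable_extinct_from i).
  by apply: bigcupT_measurable => n; exact: (measurable_extinct_from i).
(* With these constraints, [F N k] says that [N + k] is the first generation from [N] on that visits
   [B], and that [A] is avoided from [m] until just before it. *)
pose C N t : set (population d) :=
  [set z | ((m <= t)%N -> none A z) /\ ((N <= t)%N -> none B z)].
have mC N t : measurable_cond T (C N t).
  by apply: measurable_condI => phi mphi; apply: measurable_imply;
    exact: measurable_none.
pose F N k := [set w | forall t, (t < N + k)%N -> C N t (Z t w)] `&`
  [set w | ~ none B (Z (N + k)%N w)].
pose U N := [set w | forall t, (m <= t < N)%N -> none A (Z t w)] `&`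
  \bigcup_k [set w | ~ none B (Z (N + k)%N w)].
have mU N : measurable (U N).
  apply: measurableI; last by apply: bigcupT_measurable => k; exact: mB.
  apply: measurable_forall => t; apply: measurable_imply.
  exact: (@measurable_none A _ (mZ i t)).
have mF N k : measurable (F N k).
  apply: measurableI => //; apply: measurable_forall => t.
  by apply: measurable_imply; exact: (mC _ _ _ (mZ i t)).
have DF N : (m <= N)%N ->
    D `<=` \bigcup_k (F N k `&` extinct_from R Z (N + k)%N A).
  move=> mN w; rewrite /D /extinct extinct_fromE => -[Aw Bw].
  have [k kB] : exists k, ~ none B (Z (N + k)%N w).
    apply: contrapT => /forallNP nB; apply: Bw; exists N => //.
    rewrite extinct_fromE => t Nt; apply: contrapT.
    by rewrite -(subnKC Nt); exact: nB.
  have ex : exists k, `[< ~ none B (Z (N + k)%N w) >] by exists k; apply/asboolP.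
  case: (ex_minnP ex) => {kB}k /asboolP kB kmin.
  exists k => //; split; last by rewrite extinct_fromE => t Nt; apply: Aw; lia.
  split=> // t tk; split=> [mt|Nt]; first exact: Aw.
  apply: contrapT => tB; have : (k <= t - N)%N.
    by apply: kmin; apply/asboolP; rewrite subnKC.
  lia.
have tF N : trivIset setT (F N).
  apply: ltn_trivIset => k' k kk'; apply/seteqP; split=> // w [[_ wk] [wk' _]].
  have [|_] := wk' (N + k)%N; first by rewrite ltn_add2l.
  by move=> /(_ (leq_addr _ _)).
have DU N : (m <= N)%N -> P i D <= c%:E * P i (U N).
  move=> mN; have mFA k : measurable (F N k `&` extinct_from R Z (N + k)%N A).
    by apply: measurableI => //; exact: (measurable_extinct_from i).
  apply: (@le_trans _ _ (P i (\bigcup_k (F N k `&` extinct_from R Z (N + k)%N A)))).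
    by apply: le_measure; rewrite ?inE//; [exact: bigcupT_measurable|exact: DF].
  apply: le_trans (generalized_Boole_inequality _ _ _) _ => //.
    exact: bigcupT_measurable.
  apply: (@le_trans _ _ (\sum_(k <oo) c%:E * P i (F N k))).
    apply: lee_nneseries => k _ //.
    have := @extinction_after_visit A B c (mkseq (C N) (N + k)) i (F N k) c0 Bc.
    rewrite size_mkseq; apply.
      move=> t; have [tk|kt] := ltnP t (N + k); first by rewrite nth_mkseq.
      by rewrite nth_default ?size_mkseq//; exact: measurable_condT.
    congr (_ `&` _); apply/seteqP; split=> w /= Cw t tk.
      by rewrite nth_mkseq//; exact: Cw.
    by have := Cw t tk; rewrite nth_mkseq.
  rewrite nneseriesZl// lee_wpmul2l// -measure_semi_bigcup//; last first.
    exact: bigcupT_measurable.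
  apply: le_measure; rewrite ?inE//; first exact: bigcupT_measurable.
  move=> w [k _ [Cw Bw]]; split; last by exists k.
  by move=> t /andP[mt tN]; have [+ _] := Cw t (ltn_addr _ tN); exact.
(* The shift by [m] keeps the index in the range where [DU] applies. *)
have UD : P i (U (m + N)%N) @[N --> \oo] --> P i D.
  have -> : D = \bigcap_N U (m + N)%N.
    rewrite /D /extinct extinct_fromE; apply/seteqP; split=> w.
      move=> [Aw Bw] N _; split=> [t /andP[mt _]|]; first exact: Aw.
      apply: contrapT => nB; apply: Bw; exists (m + N)%N => //.
      rewrite extinct_fromE => t Nt; apply: contrapT => tB; apply: nB.
      by exists (t - (m + N))%N => //=; rewrite subnKC.
    move=> UN; split=> [t mt|[n _]].
      by have [+ _] := UN t.+1 I; apply; lia.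
    rewrite extinct_fromE => Bn; have [_ [k _]] := UN n I; apply; apply: Bn.
    lia.
  apply: (nonincreasing_cvg_mu (F := fun N => U (m + N)%N)) => //.
  - by rewrite -ge0_fin_numE// fin_num_measure.
  - exact: bigcapT_measurable.
  - move=> N N' NN'; apply/subsetPset => w [Aw [k _ Bw]]; split.
      by move=> t tN; apply: Aw; lia.
    exists (N' - N + k)%N => //=.
    by rewrite (_ : (m + N + (N' - N + k))%N = (m + N' + k)%N)//; lia.
have : P i D <= c%:E * P i D.
  apply: cvge_ge (cvgeZl (y := c%:E) _ UD) => //.
  by apply: nearW => N; apply: DU; exact: leq_addr.
have : P i D \is a fin_num by rewrite fin_num_measure.
have : 0 <= P i D by [].
case: (P i D) => // x; rewrite lee_fin -EFinM lee_fin => x0 _ xc.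
(* From [x <= c * x] with [0 <= x] and [c < 1], [x] is zero. *)
congr EFin; nra.
Qed.

End extinction.

Theorem theorem3 (R : realType) (d : nat) (hd : (1 <= d)%N)
    (p : itype d -> population d -> R) (hp : block_lower_hessenberg p)
    (disp : measure_display) (T : measurableType disp)
    (P : itype d -> probability T R) (Z : nat -> T -> population d)
    (hZ : forall i, branching_process p (P i) i Z)
    (A B : set (itype d))
    (hAB : ereal_sup [set q_from P Z 0 A i | i in B] < 1) :
  forall i, q P Z A i <= q P Z B i.
Proof.
(* A nonnegative [c] strictly between the supremum and one: the midpoint of [Num.max 0 x] and one.
   The supremum is [-oo] when [B] is empty, and then zero will do. *)
have [c [c01 Bc]] : exists c : R, (0 <= c < 1)%R /\
    forall j, B j -> q_from P Z 0 A j < c%:E.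
  have qs j : B j -> q_from P Z 0 A j <=
      ereal_sup [set q_from P Z 0 A i | i in B].
    by move=> Bj; apply: ereal_sup_ubound; exists j.
  move: hAB qs; case: ereal_sup => [x| //|] x1 qs; last first.
    exists 0%R; split; first by rewrite lexx ltr01.
    by move=> j /qs /le_lt_trans; apply; exact: ltNyr.
  rewrite lte_fin in x1; exists ((Num.max 0 x + 1) / 2)%R.
  have [x0|x0] := leP 0%R x; (split; first by lra) => j /qs /le_lt_trans;
    by apply; rewrite lte_fin; lra.
move=> i; apply: le_measure_ae.
- by apply: bigcupT_measurable => n; exact: (measurable_extinct_from hZ i).
- by apply: bigcupT_measurable => n; exact: (measurable_extinct_from hZ i).
(* Extinction of [A] is a countable union over [m], so the null sets of [extinct_null] are discarded
   together. *)
have : \forall w \ae P i, forall m,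
    ~ (extinct_from R Z m A `\` extinct R Z B) w.
  apply: ae_foralln => m.
  exists (extinct_from R Z m A `\` extinct R Z B); split.
  - apply: measurableD; first exact: (measurable_extinct_from hZ i).
    by apply: bigcupT_measurable => n; exact: (measurable_extinct_from hZ i).
  - exact: (extinct_null hp hZ m i c01 Bc).
  - by move=> w /= /contrapT.
apply: filterS => w nD [m _ Am]; apply: contrapT => nB.
by apply: (nD m); split.
Qed.
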